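(* Let $p\ge1$, let $(X,d,\mathfrak m)$ be a doubling metric measure space and let $x,y\in X$. The following properties are quantitatively equivalent: (i) there exist $C>0$ and $L\ge1$ such that for every $u\in\mathrm{Lip}(X)$ $$|u(x)-u(y)|^p\le C\,d(x,y)^{p-1}\int(\mathrm{lip}\,u)^p\,d\mathfrak m^L_{x,y};$$ (ii) there exist $C>0$ and $L\ge1$ such that for every Borel function $g:X\to[0,+\infty]$ with $g(x),g(y)<+\infty$ it holds $$\lim_{\varepsilon\to0}\ \inf_{\substack{c\in\mathscr C^\varepsilon_{x,y}\\ \ell(c)\le C d(x,y)}}\Big(\int_c g\Big)^p\le C\,d(x,y)^{p-1}\int g^p\,d\mathfrak m^L_{x,y};$$ (iii) there exist $C>0$ and $L\ge1$ such that $$|u(x)-u(y)|^p\le C\,d(x,y)^{p-1}\int g^p\,d\mathfrak m^L_{x,y}$$ for every Borel $u:X\to\mathbb R$, for every $\varepsilon>0$ and for every $g\in\mathrm{UG}^\varepsilon(u)$ such that $g(x),g(y)<+\infty$.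
   Context: A metric measure space $(X,d,\mathfrak m)$ is a separable metric space $(X,d)$ (not necessarily complete) with a non-trivial outer measure $\mathfrak m$ which is Radon and finite on bounded sets. It is doubling if there is $C_D\ge1$ with $\mathfrak m(B_{2r}(x))\le C_D\,\mathfrak m(B_r(x))$ for all $x\in X$, $r>0$. ''Quantitatively equivalent'' means that the constants in each property can be chosen depending only on the constants of any other one, on $p$ and on $C_D$. $\mathrm{Lip}(X)$ is the set of Lipschitz functions $X\to\mathbb R$ and $\mathrm{lip}\,u(z):=\lim_{\varepsilon\to0}\sup_{w\in B_\varepsilon(z),\,w\ne z}\frac{|u(w)-u(z)|}{d(z,w)}$ (equal to $0$ at isolated points). For $\varepsilon>0$, an $\varepsilon$-chain is a finite sequence of points $c=\{q_i\}_{i=0}^N$ of $X$ with $d(q_i,q_{i+1})\le\varepsilon$ for all $i$; $\alpha(c)=q_0$, $\omega(c)=q_N$, and its length is $\ell(c)=\sum_{i=0}^{N-1}d(q_i,q_{i+1})$. $\mathscr C^\varepsilon_{x,y}$ is the set of $\varepsilon$-chains $c$ with $\alpha(c)=x$, $\omega(c)=y$. For $g:X\to[0,+\infty]$, $\int_c g:=\sum_{i=0}^{N-1}\frac{g(q_i)+g(q_{i+1})}{2}d(q_i,q_{i+1})$ (with $0\cdot\infty=0$). A Borel function $g:X\to[0,+\infty]$ belongs to $\mathrm{UG}^\varepsilon(u)$ if $|u(\omega(c))-u(\alpha(c))|\le\int_c g$ for every $\varepsilon$-chain $c$. The infimum over the empty set is $+\infty$. For $x,y\in X$, $L\ge1$,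 let $B^L_{x,y}=B_{Ld(x,y)}(x)\cup B_{Ld(x,y)}(y)$ and $$R^L_{x,y}(z):=\Big(\frac{d(x,z)}{\mathfrak m(B_{d(x,z)}(x))}+\frac{d(y,z)}{\mathfrak m(B_{d(y,z)}(y))}\Big)\chi_{B^L_{x,y}}(z),\qquad R^L_{x,y}(x)=R^L_{x,y}(y)=0,$$ and $\mathfrak m^L_{x,y}:=R^L_{x,y}\,\mathfrak m$. *)

(* Defs.v *)
From HB Require Import structures.
From mathcomp Require Import all_boot all_order all_algebra.
From mathcomp Require Import all_classical all_reals all_analysis.
From mathcomp Require Import measurable_realfun.

Set Implicit Arguments.
Unset Strict Implicit.
Unset Printing Implicit Defensive.

Import Order.TTheory GRing.Theory Num.Theory.
Import numFieldNormedType.Exports.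

Local Open Scope classical_set_scope.
Local Open Scope ring_scope.
Local Open Scope ereal_scope.

(* Nonempty metric spaces: the measurable structures of the library are only
   available on pointed types. [ball x r] is the open ball (ballEmdist). *)
#[short(type="pmetricType")]
HB.structure Definition PMetric (K : numDomainType) :=
  { M of Metric K M & isPointed M }.

Section MetricMeasureSpaces.
Context {R : realType} {X : pmetricType R}.
Implicit Types (mu : {outer_measure set X -> \bar R}) (x y z : X).

Definition separable (T : topologicalType) : Prop :=
  exists2 S : set T, countable S & dense S.

(* Radon outer measures, in the sense of Mattila (Geometry of Sets and Measures
   in Euclidean Spaces, Definition 1.5); the last clause is about all sets. *)
Definition radon mu : Prop :=
  [/\ <<s @open X >> `<=` mu.-caratheodory,
      forall K : set X, compact K -> mu K < +oo,
      forall U : set X, open U ->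
        mu U = ereal_sup [set mu K | K in [set K | compact K /\ K `<=` U]] &
      forall A : set X,
        mu A = ereal_inf [set mu U | U in [set U | open U /\ A `<=` U]]].

Definition metric_bounded (A : set X) : Prop := exists x r, A `<=` ball x r.

Definition metric_measure_space mu : Prop :=
  [/\ separable X,
      mu [set: X] != 0,
      radon mu &
      forall A : set X, metric_bounded A -> mu A < +oo].

Definition doubling (CD : R) mu : Prop :=
  forall x (r : R), (0 < r)%R -> mu (ball x (2 * r)%R) <= CD%:E * mu (ball x r).

Definition borel_fun d (T : measurableType d) (f : X -> T) : Prop :=
  measurable_fun [set: g_sigma_algebraType (@open X)]
    (f : g_sigma_algebraType (@open X) -> T).

Definition Lip (u : X -> R) : Prop :=
  exists K : R, forall z w, (`|u z - u w| <= K * mdist z w)%R.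

(* The case distinction is needed since the supremum of the empty set is -oo. *)
Definition lip (u : X -> R) z : \bar R :=
  if `[< isolated [set: X] z >] then 0 else
  lim (ereal_sup [set (`|u w - u z| / mdist z w)%:E | w in ball z e `\ z]
       @[e --> 0^'+]).

(* A finite sequence q_0, ..., q_N of points is represented by its first point
   q_0 and the list s = [:: q_1; ...; q_N], as for [path]; then q_i is
   [nth q0 (q0 :: s) i] for i <= N = size s, and q_N is [last q0 s]. *)
Definition chain (e : R) (q0 : X) (s : seq X) : bool :=
  path (fun a b => mdist a b <= e)%R q0 s.

Definition chain_length (q0 : X) (s : seq X) : R :=
  (\sum_(i < size s) mdist (nth q0 (q0 :: s) i) (nth q0 (q0 :: s) i.+1))%R.

Definition chain_integral (g : X -> \bar R) (q0 : X) (s : seq X) : \bar R :=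
  \sum_(i < size s)
    (g (nth q0 (q0 :: s) i) + g (nth q0 (q0 :: s) i.+1)) * (2^-1)%:E
    * (mdist (nth q0 (q0 :: s) i) (nth q0 (q0 :: s) i.+1))%:E.

Definition chain_between (e : R) x y : set (seq X) :=
  [set s | chain e x s /\ last x s = y].

Definition UG (e : R) (u : X -> R) (g : X -> \bar R) : Prop :=
  [/\ borel_fun g, forall z, 0 <= g z &
      forall q0 s, chain e q0 s ->
        `|u (last q0 s) - u q0|%:E <= chain_integral g q0 s].

Definition two_balls (L : R) x y : set X :=
  ball x (L * mdist x y)%R `|` ball y (L * mdist x y)%R.

Definition riesz_kernel mu (L : R) x y z : \bar R :=
  if (z == x) || (z == y) then 0 else
  ((mdist x z)%:E / mu (ball x (mdist x z))
   + (mdist y z)%:E / mu (ball y (mdist y z)))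
  * (\1_(two_balls L x y) z)%:E.

(* The integral of a nonnegative f with respect to the measure of density
   [riesz_kernel mu L x y] with respect to mu, where mu is seen as a measure on
   the sigma-algebra of its Caratheodory-measurable sets. *)
Definition riesz_integral mu (L : R) x y (f : X -> \bar R) : \bar R :=
  \int[(mu : {measure set (caratheodory_type mu) -> \bar R})]_(z in setT)
    (f z * riesz_kernel mu L x y z).

Definition lip_poincare (p : R) mu x y (C L : R) : Prop :=
  forall u : X -> R, Lip u ->
    (`|u x - u y| `^ p)%:E <=
    (C * mdist x y `^ (p - 1))%:E
      * riesz_integral mu L x y (fun z => lip u z `^ p).

Definition chain_connectivity (p : R) mu x y (C L : R) : Prop :=
  forall g : X -> \bar R, borel_fun g -> (forall z, 0 <= g z) ->
    g x < +oo -> g y < +oo ->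
    lim (ereal_inf [set chain_integral g x s `^ p | s in
           chain_between e x y `&`
           [set s | (chain_length x s <= C * mdist x y)%R]]
         @[e --> 0^'+]) <=
    (C * mdist x y `^ (p - 1))%:E
      * riesz_integral mu L x y (fun z => g z `^ p).

Definition chain_poincare (p : R) mu x y (C L : R) : Prop :=
  forall u : X -> R, borel_fun u ->
  forall e : R, (0 < e)%R ->
  forall g : X -> \bar R, UG e u g -> g x < +oo -> g y < +oo ->
    (`|u x - u y| `^ p)%:E <=
    (C * mdist x y `^ (p - 1))%:E
      * riesz_integral mu L x y (fun z => g z `^ p).

End MetricMeasureSpaces.

Definition two_point_property (R : realType) : Type :=
  forall X : pmetricType R, {outer_measure set X -> \bar R} ->
    X -> X -> R -> R -> Prop.

(* The constants of Q depend only on those of P and on CD (and on whatever P and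
   Q depend on): they are chosen before the space, the measure and the points. *)
Definition quantitatively_implies (R : realType) (P Q : two_point_property R) :
    Prop :=
  forall CD C L : R, (1 <= CD)%R -> (0 < C)%R -> (1 <= L)%R ->
  exists C' L' : R, [/\ (0 < C')%R, (1 <= L')%R &
    forall (X : pmetricType R) (mu : {outer_measure set X -> \bar R}),
      metric_measure_space mu -> doubling CD mu ->
      forall x y : X, P X mu x y C L -> Q X mu x y C' L'].

Definition quantitatively_equivalent (R : realType)
    (P Q : two_point_property R) : Prop :=
  quantitatively_implies P Q /\ quantitatively_implies Q P.

(* Main.v *)
Require Import Defs.
From mathcomp Require Import all_boot all_order all_algebra.
From mathcomp Require Import all_classical all_reals all_analysis.
From mathcomp Require Import measurable_realfun.
From mathcomp Require Import lra ring.

(** The three properties are linked in a cycle: (i) implies (ii), (ii) implies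
(iii), (iii) implies (i).

(ii) implies (iii), with the same constants: if [g] is an upper gradient of [u]
along [e]-chains, the integral of [g] along any [e]-chain from [x] to [y] is at
least the difference of [u]; the infimum in (ii) increases as the mesh tends to
zero, so its limit is at least its value at mesh [e].

(iii) implies (i), with the same constants: for a Lipschitz function [u] the
largest difference quotient [slope u e z] on the punctured ball of radius [e] is
lower semicontinuous in [z], bounded, and an upper gradient of [u] along
[r]-chains for [r < e] ([UG_slope]).  It decreases to [lip u] as [e] tends to
zero, and dominated convergence applies because the Riesz kernel has finite mass.

(i) implies (ii) is the main point ([chain_of_Lip_bound]).  Given [h] bounded
below by a positive constant and a small radius [r], let [G z] be the infimum of
[h] over the ball of centre [z] and radius [r], truncated to be bounded, and let
[u z] be the infimum of the integrals of [G] along the [r]-chains from [x] to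
[z], also truncated.  Then [u] is Lipschitz.  If [w] is closer to [z] than [r],
both [G z] and [G w] are at most [h z], hence [lip u <= h] pointwise, however
irregular [h] may be.  If (i) bounds [u x - u y] by [A], some [r]-chain from [x]
to [y] has [G]-integral less than [2 * A].  Cut it into blocks of diameter
comparable to [r].  Each block contains a point where [G] is at most twice the cost of the
block divided by [r], and within distance [r] of it lies a point where [h] is
just as small.  The points chosen in this way form a chain of mesh [8 * r] along
which the integral of [h] is at most a universal multiple of [A]
([chain_thinning]).

The lemma is applied to [h = g + l] with a positive constant [l]: then the
integral of [h] along a chain is at least [l] times its length, so that a single
bound controls both the integral of [g] and the length.  The right-hand side of
(i) for [h] is controlled since the mass of the Riesz kernel is at most a
multiple of [mdist x y] ([riesz_mass_le], where the doubling condition is used),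
and [l] is chosen so that the contributions of [g] and [l] to it balance. *)

Set Implicit Arguments.
Unset Strict Implicit.
Unset Printing Implicit Defensive.

Import Order.TTheory GRing.Theory Num.Theory.
Import numFieldNormedType.Exports.

Local Open Scope classical_set_scope.
Local Open Scope ring_scope.
Local Open Scope ereal_scope.

(** * Difference quotients and the pointwise Lipschitz constant *)

Section PointwiseLipschitzConstant.
Context {R : realType} {X : pmetricType R}.
Implicit Types (x y z w : X) (u : X -> R) (e : R).

(** The element [0] keeps the supremum nonnegative where the punctured ball is
empty, which makes [lip u z] the infimum of the slopes at every point, isolated
or not. *)
Definition slope u e z : \bar R :=
  ereal_sup (0 |` [set (`|u w - u z| / mdist z w)%:E | w in ball z e `\ z]).

Lemma slope_ge0 u e z : 0 <= slope u e z.
Proof. by apply: ereal_sup_ubound; left. Qed.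

Lemma le_slope u e1 e2 z : (e1 <= e2)%R -> slope u e1 z <= slope u e2 z.
Proof.
move=> e12; apply: le_ereal_sup; apply: setUS => _ [w [zw wz] <-].
by exists w => //; split => //; exact: le_ball zw.
Qed.

Lemma slope_le u e z (K : \bar R) : 0 <= K ->
  (forall w, (mdist z w < e)%R -> (`|u w - u z|)%:E <= K * (mdist z w)%:E) ->
  slope u e z <= K.
Proof.
move=> K0 uK; apply: ge_ereal_sup => _ [->//|[w [zw wz] <-]].
have d0 : (0 < mdist z w)%R.
  by rewrite mdist_gt0; apply/eqP => zw'; apply: wz; rewrite /= zw'.
rewrite EFinM lee_pdivrMr// uK//.
by move: zw; rewrite ballEmdist.
Qed.

Lemma lipE u z : lip u z = ereal_inf [set slope u e z | e in `]0%R, +oo[].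
Proof.
rewrite /lip; case: asboolP => [[_ [V Vz VT]]|nisol].
  apply/eqP; rewrite eq_le; apply/andP; split.
    by apply: le_ereal_inf_tmp => _ [e _ <-]; exact: slope_ge0.
  have [e/= e0 eV] := (nbhs_ballP z V).1 Vz.
  apply: ge_ereal_inf; exists (slope u e z).
    by exists e => //=; rewrite in_itv/= andbT.
  apply: ge_ereal_sup => t [->//|[w [zw wz] _]].
  have : (V `&` [set: X]) w by split => //; exact: eV.
  by rewrite VT.
set S := fun e : R => ereal_sup
  [set (`|u w - u z| / mdist z w)%:E | w in ball z e `\ z].
have Sslope e : (0 < e)%R -> S e = slope u e z.
  move=> e0; apply/eqP; rewrite eq_le; apply/andP; split.
    by apply: le_ereal_sup; exact: subsetUr.
  have [w [zw wz]] : (ball z e `\ z) !=set0.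
    apply/set0P/eqP => b0; apply: nisol; split; first by rewrite inE.
    exists (ball z e); first exact: nbhsx_ballx.
    rewrite setIT; apply/seteqP; split => [w zw|_ ->]; last exact: ballxx.
    by apply: contrapT => wz; have : set0 w by rewrite -b0.
  apply: ge_ereal_sup => _ [->|[w' w'z <-]].
    apply: le_ereal_sup_tmp; exists (`|u w - u z| / mdist z w)%:E.
      by exists w.
    by rewrite lee_fin divr_ge0// mdist_ge0.
  by apply: ereal_sup_ubound; exists w'.
have -> : lim (S e @[e --> 0^'+]) = ereal_inf [set S e | e in `]0%R, +oo[].
  apply/cvg_lim => //; apply: (nondecreasing_at_right_cvge (BInfty _ false)) => //.
  move=> e1 e2 _ _ e12; apply: le_ereal_sup => _ [w [zw wz] <-].
  by exists w => //; split => //; exact: le_ball zw.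
by congr ereal_inf; apply: eq_imagel => e /=; rewrite in_itv/= andbT; exact: Sslope.
Qed.

Lemma lip_le_slope u e z : (0 < e)%R -> lip u z <= slope u e z.
Proof.
move=> e0; rewrite lipE; apply: ereal_inf_lbound; exists e => //=.
by rewrite in_itv/= e0.
Qed.

Lemma lip_ge0 u z : 0 <= lip u z.
Proof.
by rewrite lipE; apply: le_ereal_inf_tmp => _ [e _ <-]; exact: slope_ge0.
Qed.

Lemma lip_inf_seq u z :
  lip u z = ereal_inf (range (fun n => slope u n.+1%:R^-1 z)).
Proof.
rewrite lipE; apply/eqP; rewrite eq_le; apply/andP; split.
  apply: le_ereal_inf => _ [n _ <-]; exists n.+1%:R^-1%R => //=.
  by rewrite in_itv/= andbT invr_gt0.
apply: le_ereal_inf_tmp => t [e /=]; rewrite in_itv/= andbT => e0 <-{t}.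
have [n _ /(_ _ (leqnn n)) ne] := near_infty_natSinv_lt (PosNum e0).
apply: ge_ereal_inf; exists (slope u n.+1%:R^-1 z); first by exists n.
exact/le_slope/ltW.
Qed.

Lemma slope_cvg u z : slope u n.+1%:R^-1 z @[n --> \oo] --> lip u z.
Proof.
rewrite lip_inf_seq; apply: ereal_nonincreasing_cvgn => m n mn.
by apply: le_slope; rewrite lef_pV2 ?posrE// ler_nat.
Qed.

End PointwiseLipschitzConstant.

(** * Integrals along chains *)

Section Chains.
Context {R : realType} {X : pmetricType R}.
Implicit Types (x y z w : X) (s : seq X) (g h : X -> \bar R) (e r : R).

Definition chain_step g a b : \bar R := (g a + g b) * (2^-1)%:E * (mdist a b)%:E.

Lemma chain_integral_nil g x : chain_integral g x [::] = 0.
Proof. by rewrite /chain_integral big_ord0. Qed.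

Lemma chain_integral_cons g x a s :
  chain_integral g x (a :: s) = chain_step g x a + chain_integral g a s.
Proof.
rewrite /chain_integral/= big_ord_recl/=; congr (_ + _).
apply: eq_bigr => i _; rewrite add0n.
by rewrite !(set_nth_default a x)//= ltnS ltnW.
Qed.

Lemma chain_length_nil x : chain_length x [::] = 0%R.
Proof. by rewrite /chain_length big_ord0. Qed.

Lemma chain_length_cons x a s :
  chain_length x (a :: s) = (mdist x a + chain_length a s)%R.
Proof.
rewrite /chain_length/= big_ord_recl/=; congr (_ + _)%R.
apply: eq_bigr => i _; rewrite add0n.
by rewrite !(set_nth_default a x)//= ltnS ltnW.
Qed.

Lemma chain_step_ge0 g a b : (forall z, 0 <= g z) -> 0 <= chain_step g a b.
Proof.
by move=> g0; rewrite /chain_step !mule_ge0 ?adde_ge0// lee_fin ?mdist_ge0.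
Qed.

Lemma chain_integral_ge0 g x s : (forall z, 0 <= g z) -> 0 <= chain_integral g x s.
Proof.
move=> g0; elim: s x => [|a s IH] x; first by rewrite chain_integral_nil.
by rewrite chain_integral_cons adde_ge0// chain_step_ge0.
Qed.

Lemma le_chain_integral g h x s : (forall z, 0 <= g z) -> (forall z, g z <= h z) ->
  chain_integral g x s <= chain_integral h x s.
Proof.
move=> g0 gh; elim: s x => [|a s IH] x; first by rewrite !chain_integral_nil.
rewrite !chain_integral_cons leeD// /chain_step.
rewrite lee_wpmul2r ?lee_fin ?mdist_ge0// lee_wpmul2r ?lee_fin//.
by rewrite leeD.
Qed.

Lemma chain_integral_cat g x s1 s2 :
  chain_integral g x (s1 ++ s2) =
  chain_integral g x s1 + chain_integral g (last x s1) s2.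
Proof.
elim: s1 x => [|a s1 IH] x; first by rewrite chain_integral_nil add0e.
by rewrite cat_cons !chain_integral_cons IH addeA.
Qed.

Lemma chain_integral_lbound g x s (m : R) : (0 <= m)%R ->
  (forall z, z \in x :: s -> m%:E <= g z) ->
  (m * chain_length x s)%:E <= chain_integral g x s.
Proof.
move=> m0; elim: s x => [|a s IH] x mg.
  by rewrite chain_length_nil chain_integral_nil mulr0.
rewrite chain_length_cons chain_integral_cons mulrDr EFinD leeD//; last first.
  by apply: IH => z zs; apply: mg; rewrite inE zs orbT.
rewrite /chain_step EFinM lee_wpmul2r ?lee_fin ?mdist_ge0//.
rewrite lee_pdivlMr// -EFinM mulr_natr mulr2n EFinD leeD// mg// !inE eqxx//.
by rewrite orbT.
Qed.

Lemma mdist_le_chain_length x s : (mdist x (last x s) <= chain_length x s)%R.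
Proof.
elim: s x => [|a s IH] x; first by rewrite mdistxx chain_length_nil.
by rewrite chain_length_cons (le_trans (metric_triangle _ a _))// lerD2l.
Qed.

(** Each point of [s] is the endpoint of at most two steps, each of which charges
it with half of a length at most [e]. *)
Lemma chain_integral_ubound g x s e : (0 <= e)%R -> (forall z, 0 <= g z) ->
  chain e x s ->
  chain_integral g x s <= e%:E * (g x + \sum_(w <- s) g w).
Proof.
(* The first point is charged only once, and the factor [2^-1] on it is what
   makes the induction close. *)
move=> e0 g0 xs; suff : chain_integral g x s <=
    e%:E * (g x * (2^-1)%:E + \sum_(w <- s) g w).
  move=> /le_trans; apply; rewrite lee_wpmul2l// leeD//.
  by rewrite -[leRHS]mule1 lee_wpmul2l// lee_fin invf_le1// ler1n.
elim: s x xs => [|a s IH] x; first rewrite chain_integral_nil.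
  by rewrite big_nil adde0 !mule_ge0.
move=> /= /andP[xa /IH {}IH]; rewrite chain_integral_cons big_cons.
apply: (@le_trans _ _ (e%:E * ((g x + g a) * (2^-1)%:E) +
    e%:E * (g a * (2^-1)%:E + \sum_(w <- s) g w))).
  by rewrite leeD// /chain_step muleC lee_wpmul2r ?lee_fin// mule_ge0 ?adde_ge0.
have s0 : 0 <= \sum_(w <- s) g w by exact: sume_ge0.
rewrite -ge0_muleDr ?adde_ge0 ?mule_ge0 ?adde_ge0//.
rewrite lee_wpmul2l// addeA ge0_muleDl// -addeA -addeA leeD2l// addeA leeD2r//.
by rewrite -ge0_muleDr// -EFinD -[(2^-1)%R]div1r -splitr mule1.
Qed.

End Chains.

(** * Thinning a chain *)

Section Thinning.
Context {R : realType} {X : pmetricType R}.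
Implicit Types (x y z w : X) (s : seq X) (e r : R).

(** Cut the chain each time it has moved away by [r] from the beginning of the
current block.  A block has length at least [r], so its cost [c] forces [G] to be
less than [2 * c / r] somewhere in it; the hypothesis on [h] and [G] then gives
a nearby point where [h] is less than this, and these points form the new chain.
The positive lower bound [l] makes [c] positive, so that [G] cannot be at least
[2 * c / r] on a whole block of cost [c], and the bound on the total cost keeps
[2 * c / r] below the level [N] at which [G] is truncated.  The point [v] is the
last point chosen so far: it is within [2 * r + r] of the beginning of the
preceding block, itself within [2 * r] of [q]. *)
Lemma chain_thinning (h : X -> \bar R) (G : X -> R) (r l N : R) :
  (forall z, 0 <= h z) -> (0 < r)%R -> (0 < l)%R -> (forall z, (l <= G z)%R) ->
  (forall z (K : R), (K <= N)%R -> (G z < K)%R ->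
     exists2 w, (mdist z w < r)%R & h w < K%:E) ->
  forall n q s v, (size s <= n)%N -> chain r q s ->
  chain_integral (EFin \o G) q s <= (r * N / 2)%:E ->
  (mdist v q <= 5 * r)%R ->
  exists2 t, chain (8 * r) v (rcons t (last q s)) &
    r%:E * \sum_(w <- t) h w <= 2%:E * chain_integral (EFin \o G) q s.
Proof.
move=> h0 r0 l0 lG hG; elim=> [|n IH] q s v sn qs costN vq.
  move: sn; rewrite leqn0 size_eq0 => /eqP ->; exists [::].
    by rewrite /chain/= andbT; lra.
  by rewrite big_nil mule0 chain_integral_nil mule0.
have G0 z : 0 <= (EFin \o G) z by rewrite lee_fin (le_trans (ltW l0)).
have [|far] := boolP (has (fun z => r <= mdist q z)%R s); last first.
  exists [::]; last by rewrite big_nil mule0 mule_ge0// chain_integral_ge0.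
  rewrite /chain/= andbT; have [->|sq] := eqVneq s [::]; first by move=> /=; lra.
  have qy : (mdist q (last q s) < r)%R.
    rewrite ltNge; apply: contra far => far; apply/hasP; exists (last q s) => //.
    by case: s sq {sn qs costN far} => // a s _; rewrite /= mem_last.
  have := metric_triangle v q (last q s); lra.
move=> hs; have [b [s1 [s2 [Es rqb near1]]]] : exists b s1 s2,
    [/\ s = rcons s1 b ++ s2, (r <= mdist q b)%R &
        forall z, z \in s1 -> (mdist q z < r)%R].
  have /= := split_find hs; case: _ _ _ / => b s1 s2 rqb /hasPn ns1.
  by exists b, s1, s2; split => // z /ns1; rewrite -ltNge.
move: qs sn costN; rewrite {}Es {hs} /chain cat_path last_rcons rcons_path.
move=> /andP[/andP[qs1 s1b] bs2] sn.
rewrite chain_integral_cat last_rcons => costN.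
have qs1r : (mdist q (last q s1) < r)%R.
  by have := mem_last q s1; rewrite inE => /orP[/eqP ->|/near1//]; rewrite mdistxx.
have qb : (mdist q b <= 2 * r)%R by have := metric_triangle q (last q s1) b; lra.
set c1 := chain_integral _ q _; set c2 := chain_integral _ b _ in costN *.
have c10 : 0 <= c1 by exact: chain_integral_ge0.
have c20 : 0 <= c2 by exact: chain_integral_ge0.
have c1N : c1 <= (r * N / 2)%:E by rewrite (le_trans _ costN)// leeDl.
have c2N : c2 <= (r * N / 2)%:E by rewrite (le_trans _ costN)// leeDr.
have /fineK c1E : c1 \is a fin_num by rewrite ge0_fin_numE// (le_lt_trans c1N)// ltry.
have lenr : (r <= chain_length q (rcons s1 b))%R.
  by have := mdist_le_chain_length q (rcons s1 b); rewrite last_rcons; apply: le_trans.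
have k0 : (0 < fine c1)%R.
  rewrite -lte_fin c1E; apply: (@lt_le_trans _ _ (l * chain_length q (rcons s1 b))%:E).
    by rewrite lte_fin mulr_gt0// (lt_le_trans r0).
  by apply: chain_integral_lbound => [|z _]; [exact: ltW|rewrite lee_fin].
have [z zb [w zw hw]] : exists2 z, z \in q :: rcons s1 b &
    exists2 w, (mdist z w < r)%R & h w < (2 * fine c1 / r)%:E.
  apply: contrapT => noz.
  have kN : (2 * fine c1 / r <= N)%R.
    by move: c1N; rewrite -c1E lee_fin ler_pdivrMr//; lra.
  have : ((2 * fine c1 / r) * chain_length q (rcons s1 b))%:E <= c1.
    apply: chain_integral_lbound => [|z zb].
      by rewrite divr_ge0 ?mulr_ge0// ltW.
    rewrite lee_fin leNgt; apply/negP => Gz; apply: noz; exists z => //.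
    exact: hG Gz.
  rewrite -c1E lee_fin; apply/negP; rewrite -ltNge.
  apply: (@lt_le_trans _ _ (2 * fine c1 / r * r)%R).
    by rewrite divfK ?gt_eqF//; lra.
  by rewrite ler_wpM2l// divr_ge0 ?mulr_ge0// ltW.
have qz : (mdist q z <= 2 * r)%R.
  move: zb; rewrite inE mem_rcons inE => /or3P[/eqP ->|/eqP ->//|/near1 zr].
    by rewrite mdistxx mulr_ge0// ltW.
  lra.
have [||||t vt ht] := IH b s2 w => //.
- by move: sn; rewrite size_cat size_rcons addSn ltnS; apply/leq_trans/leq_addl.
- have := metric_triangle w z b; have := metric_triangle z q b.
  rewrite (metric_sym w z) (metric_sym z q); lra.
exists (w :: t).
  rewrite last_cat last_rcons; apply/andP; split; last exact: vt.
  have := metric_triangle v q w; have := metric_triangle q z w; lra.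
rewrite big_cons ge0_muleDr ?sume_ge0// [leRHS]ge0_muleDr// leeD//.
apply: (@le_trans _ _ (r%:E * (2 * fine c1 / r)%:E)).
  by apply: lee_wpmul2l; [rewrite lee_fin|]; exact: ltW.
by rewrite -EFinM mulrCA divff ?gt_eqF// mulr1 EFinM c1E.
Qed.

End Thinning.

(** * From Lipschitz functions to chains *)

Section EikonalFunction.
Context {R : realType} {X : pmetricType R}.
Implicit Types (x y z w : X) (s : seq X) (e r : R).

(** The distance from [x] for the length element [G], discretised at scale [r];
the truncation at [M] also covers the points that no [r]-chain reaches. *)
Definition chain_distance (G : X -> R) (r M : R) x z : \bar R :=
  ereal_inf (M%:E |`
    [set chain_integral (EFin \o G) x s | s in chain_between r x z]).

Definition eikonal (G : X -> R) (r M : R) x z : R := fine (chain_distance G r M x z).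

Variables (G : X -> R) (r M : R) (x : X).
Hypotheses (G0 : forall z, (0 <= G z)%R) (M0 : (0 <= M)%R) (r0 : (0 < r)%R).
Let Ge0 z : 0 <= (EFin \o G) z. Proof. by rewrite lee_fin. Qed.
Let u := eikonal G r M x.

Lemma eikonalK z : (u z)%:E = chain_distance G r M x z.
Proof.
rewrite fineK// ge0_fin_numE.
  by rewrite (@le_lt_trans _ _ M%:E) ?ltry//; apply: ereal_inf_lbound; left.
apply: le_ereal_inf_tmp => _ [->|[s _ <-]]; first by rewrite lee_fin.
exact: chain_integral_ge0.
Qed.

Lemma eikonal_ge0 z : (0 <= u z)%R.
Proof.
rewrite -lee_fin eikonalK.
apply: le_ereal_inf_tmp => _ [->|[s _ <-]]; first by rewrite lee_fin.
exact: chain_integral_ge0.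
Qed.

Lemma eikonal_le z : (u z <= M)%R.
Proof. by rewrite -lee_fin eikonalK; apply: ereal_inf_lbound; left. Qed.

Lemma eikonalxx : u x = 0%R.
Proof.
apply/eqP; rewrite eq_le eikonal_ge0 andbT -lee_fin eikonalK.
by apply: ereal_inf_lbound; right; exists [::] => //; rewrite chain_integral_nil.
Qed.

Lemma eikonal_lt z (K : R) : (K <= M)%R -> (u z < K)%R ->
  exists2 s, chain_between r x z s & chain_integral (EFin \o G) x s < K%:E.
Proof.
move=> KM; rewrite -lte_fin eikonalK => /ereal_inf_lt[t [->|[s xz <-] sK]].
  by rewrite lte_fin ltNge KM.
by exists s.
Qed.

Let eikonal_step z w : (mdist z w <= r)%R ->
  (u w <= u z + (G z + G w) / 2 * mdist z w)%R.
Proof.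
move=> zw; rewrite -lerBlDr -lee_fin eikonalK.
apply: le_ereal_inf_tmp => _ [->|[s [xs sz] <-]].
  rewrite lee_fin lerBlDr (le_trans (eikonal_le _))// lerDl.
  by rewrite mulr_ge0 ?mdist_ge0// divr_ge0// addr_ge0.
rewrite EFinB leeBlDr// eikonalK; apply: ereal_inf_lbound; right.
exists (rcons s w).
  by split; rewrite ?last_rcons// /chain rcons_path sz zw andbT.
by rewrite -cats1 chain_integral_cat chain_integral_cons chain_integral_nil adde0 sz.
Qed.

(** Appending one step to a chain shows that [u] behaves at scale [r] as a
solution of the eikonal equation with speed [1 / G]. *)
Lemma eikonal_slope z w : (mdist z w <= r)%R ->
  (`|u w - u z| <= (G z + G w) / 2 * mdist z w)%R.
Proof.
move=> zw; have := eikonal_step zw; have := @eikonal_step w z.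
rewrite (metric_sym w z) (addrC (G w)) => /(_ zw).
move: (_ / 2 * _)%R => k uzw uwz; rewrite ler_norml; apply/andP; split; lra.
Qed.

(** At distances larger than [r] the truncation at [M] bounds the quotient. *)
Lemma Lip_eikonal (N : R) : (forall z, (G z <= N)%R) -> Lip u.
Proof.
move=> GN; exists (N + M / r)%R => z w.
have [zw|zw] := leP (mdist z w) r.
  rewrite distrC (le_trans (eikonal_slope zw))// ler_wpM2r ?mdist_ge0//.
  have := GN z; have := GN w; have : (0 <= M / r)%R by rewrite divr_ge0// ltW.
  lra.
apply: (@le_trans _ _ M).
  have := eikonal_ge0 z; have := eikonal_ge0 w.
  have := eikonal_le z; have := eikonal_le w.
  by rewrite ler_norml; lra.
apply: (@le_trans _ _ (M / r * mdist z w)%R).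
  by rewrite -[leLHS](divfK (lt0r_neq0 r0)) ler_wpM2l ?divr_ge0// ltW.
by rewrite ler_wpM2r ?mdist_ge0// lerDr (le_trans (G0 z)).
Qed.

End EikonalFunction.

Section ChainsFromLipschitzFunctions.
Context {R : realType} {X : pmetricType R}.
Implicit Types (x y z w : X) (s : seq X) (e r : R).

(** The converse of the upper gradient inequality: if Lipschitz functions with
pointwise Lipschitz constant at most [h] cannot separate [x] from [y] by more
than [A], then [x] and [y] are joined by chains of arbitrarily small mesh with
[h]-integral comparable to [A].  The extremal function is the distance for the
length element obtained by taking infima of [h] over small balls. *)
Lemma chain_of_Lip_bound (h : X -> \bar R) (l A : R) x y :
  (0 < l)%R -> (0 < A)%R -> (forall z, l%:E <= h z) -> h x < +oo -> h y < +oo ->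
  (forall u, Lip u -> (forall z, lip u z <= h z) -> (`|u x - u y| <= A)%R) ->
  forall e, (0 < e)%R ->
  exists2 s, chain_between e x y s & chain_integral h x s <= (33 * A)%:E.
Proof.
move=> l0 A0 lh hx hy uA e e0.
have h0 z : 0 <= h z by rewrite (le_trans _ (lh z))// lee_fin ltW.
have hfin z : h z < +oo -> h z = (fine (h z))%:E.
  by move=> hz; rewrite fineK// ge0_fin_numE.
have [r [r0 re rA]] : exists r : R,
    [/\ 0 < r, 8 * r <= e & 8 * r * (fine (h x) + fine (h y)) <= A]%R.
  have H0 : (0 < fine (h x) + fine (h y))%R.
    by rewrite ltr_wpDr ?fine_ge0// -lte_fin -hfin// (lt_le_trans _ (lh x))// lte_fin.
  exists (Num.min (e / 8) (A / (fine (h x) + fine (h y)) / 8))%R.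
  split; first by rewrite lt_min !divr_gt0.
    by rewrite mulrC -ler_pdivlMr// ge_min lexx.
  by rewrite -ler_pdivlMr// mulrC -ler_pdivlMr// ge_min lexx orbT.
(* [r * N / 2 = 2 * A] is the cost allowed to the chain that gets thinned. *)
pose N := (4 * A / r)%R.
have N0 : (0 < N)%R by rewrite divr_gt0// mulr_gt0.
pose Ge z := ereal_inf (N%:E |` (h @` ball z r)).
pose l' := Num.min l N.
have l'0 : (0 < l')%R by rewrite lt_min l0.
have l'Ge z : l'%:E <= Ge z.
  apply: le_ereal_inf_tmp => _ [->|[w _ <-]]; first by rewrite lee_fin ge_min lexx orbT.
  by rewrite (le_trans _ (lh w))// lee_fin ge_min lexx.
have GeN z : Ge z <= N%:E by apply: ereal_inf_lbound; left.
have GE z : (fine (Ge z))%:E = Ge z.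
  rewrite fineK// ge0_fin_numE ?(le_lt_trans (GeN z)) ?ltry//.
  by rewrite (le_trans _ (l'Ge z))// lee_fin ltW.
pose G z := fine (Ge z).
have l'G z : (l' <= G z)%R by rewrite -lee_fin GE.
have GN z : (G z <= N)%R by rewrite -lee_fin GE.
have G0 z : (0 <= G z)%R by rewrite (le_trans (ltW l'0)).
have Gh z w : (mdist z w < r)%R -> (G z)%:E <= h w.
  move=> zw; rewrite GE; apply: ereal_inf_lbound; right; exists w => //.
  by rewrite ballEmdist.
have hG z (K : R) : (K <= N)%R -> (G z < K)%R ->
    exists2 w, (mdist z w < r)%R & h w < K%:E.
  move=> KN; rewrite -lte_fin GE => /ereal_inf_lt[t [->|[w zw <-] wK]].
    by rewrite lte_fin ltNge KN.
  by exists w => //; move: zw; rewrite ballEmdist.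
have M0 : (0 <= 2 * A)%R by rewrite mulr_ge0// ltW.
pose u := eikonal G r (2 * A) x.
(* Both [G z] and [G w] are at most [h z] when [w] is closer to [z] than [r]. *)
have : (`|u x - u y| <= A)%R.
  apply: uA; first exact: (Lip_eikonal x G0 M0 r0 GN).
  move=> z; apply: (le_trans (lip_le_slope _ _ r0)).
  apply: slope_le => // w zw.
  apply: (@le_trans _ _ ((G z + G w) / 2 * mdist z w)%:E).
    by rewrite lee_fin eikonal_slope// ltW.
  rewrite EFinM lee_wpmul2r ?lee_fin ?mdist_ge0//.
  have [hz|] := ltP (h z) +oo; last by rewrite leye_eq => /eqP ->; rewrite leey.
  have := Gh w z; have := Gh z z; rewrite mdistxx metric_sym => /(_ r0) + /(_ zw).
  by rewrite hfin// !lee_fin; lra.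
rewrite /u eikonalxx// sub0r normrN ger0_norm ?eikonal_ge0// => uyA.
have u2A : (u y < 2 * A)%R by rewrite (le_lt_trans uyA)//; lra.
have [s [xs sy] sA] := eikonal_lt G0 M0 (lexx _) u2A.
have cN : chain_integral (EFin \o G) x s <= (r * N / 2)%:E.
  rewrite (le_trans (ltW sA))// lee_fin /N mulrCA divff ?gt_eqF//; lra.
have xx5 : (mdist x x <= 5 * r)%R by rewrite mdistxx mulr_ge0// ltW.
have [t xt ht] := chain_thinning h0 r0 l'0 l'G hG (leqnn _) xs cN xx5.
rewrite sy in xt; exists (rcons t y).
  split; last by rewrite last_rcons.
  by apply: sub_path xt => a b /le_trans; apply.
apply: (le_trans (chain_integral_ubound _ h0 xt)); first by rewrite mulr_ge0// ltW.
rewrite -cats1 big_cat big_seq1/=.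
have S0 : 0 <= \sum_(w <- t) h w by exact: sume_ge0.
rewrite (addeC (\sum_(w <- t) h w)) addeA ge0_muleDr ?adde_ge0//.
have -> : (33 * A)%:E = A%:E + (8 * (4 * A))%:E by rewrite -EFinD; congr EFin; ring.
rewrite leeD//; first by rewrite (hfin x)// (hfin y)// -EFinD -EFinM lee_fin.
rewrite !EFinM -muleA lee_wpmul2l// (le_trans ht)//.
rewrite (_ : 4%:E * A%:E = 2%:E * (2 * A)%:E); last by rewrite -!EFinM; congr EFin; ring.
by rewrite lee_wpmul2l// ltW.
Qed.

End ChainsFromLipschitzFunctions.

(** * Borel functions and measures of balls *)

Section BorelFunctions.
Context {R : realType} {X : pmetricType R}.
Implicit Types (x y z w : X).

Lemma metric_ball_open x (r : R) : open (ball x r).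
Proof.
rewrite openE => z; rewrite ballEmdist/= => xz; apply/nbhs_ballP.
exists (r - mdist x z)%R; first by rewrite /= subr_gt0.
move=> w; rewrite !ballEmdist/= => zw; have := metric_triangle x z w; lra.
Qed.

Lemma mdist_gt_open x (r : R) : open [set z | (r < mdist x z)%R].
Proof.
rewrite openE => z /= rxz; apply/nbhs_ballP.
exists (mdist x z - r)%R; first by rewrite /= subr_gt0.
move=> w; rewrite !ballEmdist/= => zw; have := metric_triangle x w z.
by rewrite (metric_sym w z); lra.
Qed.

Lemma borel_lsc (f : X -> \bar R) :
  (forall r : R, open [set z | r%:E < f z]) -> borel_fun f.
Proof.
move=> fo; apply: (measurability _ (ErealGenOInfty.measurableE R)).
move=> /= _ [_ [a ->]] <-; rewrite setTI; apply: sub_sigma_algebra.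
by rewrite preimage_itvoy; exact: fo.
Qed.

Lemma borel_mdist x : borel_fun (mdist x : X -> R).
Proof.
apply: (measurability _ (RGenOInfty.measurableE R)).
move=> /= _ [_ [a ->]] <-; rewrite setTI; apply: sub_sigma_algebra.
by rewrite preimage_itvoy; exact: mdist_gt_open.
Qed.

End BorelFunctions.

Section Balls.
Context {R : realType} {X : pmetricType R}.
Variables (mu : {outer_measure set X -> \bar R}) (CD : R).
Hypotheses (mmu : metric_measure_space mu) (dmu : doubling CD mu).
Implicit Types (x y z : X) (r : R).

Lemma mu_ball_lty x r : mu (ball x r) < +oo.
Proof. by case: mmu => _ _ _; apply; exists x, r. Qed.

(** If one ball were null, doubling would make all its concentric enlargements
null, hence the whole space. *)
Lemma mu_ball_gt0 x r : (0 < r)%R -> 0 < mu (ball x r).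
Proof.
move=> r0; rewrite lt0e outer_measure_ge0 andbT; apply/eqP => mu0.
have mu0n n : mu (ball x ((2 ^ n)%:R * r)%R) = 0.
  elim: n => [|n IH]; first by rewrite expn0 mul1r.
  apply/eqP; rewrite eq_le outer_measure_ge0 andbT.
  rewrite expnS natrM -mulrA (le_trans (dmu _ _)) ?IH ?mule0//.
  by rewrite mulr_gt0// ltr0n expn_gt0.
case: mmu => _ /eqP + _ _; apply; apply/eqP.
rewrite eq_le outer_measure_ge0 andbT.
have -> : [set: X] = \bigcup_n ball x ((2 ^ n)%:R * r)%R.
  apply/esym; rewrite -subTset => z _.
  have [n nz] : exists n : nat, (mdist x z / r < n%:R)%R.
    by exists (Num.bound (mdist x z / r)); rewrite archi_boundP// divr_ge0 ?mdist_ge0// ltW.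
  exists n => //; rewrite ballEmdist/= -ltr_pdivrMr// (lt_le_trans nz)//.
  by rewrite ler_nat ltnW// ltn_expl.
rewrite (le_trans (outer_measure_sigma_subadditive _ _))//.
by rewrite eseries0// => i _ _; rewrite mu0n.
Qed.

Lemma mu_ball_fineK x r : (fine (mu (ball x r)))%:E = mu (ball x r).
Proof. by rewrite fineK// ge0_fin_numE ?mu_ball_lty// outer_measure_ge0. Qed.

Lemma borel_fun_caratheodory d (T : measurableType d) (f : X -> T) :
  borel_fun f -> measurable_fun [set: caratheodory_type mu] f.
Proof.
move=> bf mD Y mY; rewrite setTI.
have [_ _ [sub _ _ _] _] := mmu.
by apply: sub; have := bf measurableT Y mY; rewrite setTI.
Qed.

Lemma open_caratheodory (U : set X) : open U -> measurable (U : set (caratheodory_type mu)).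
Proof.
move=> oU; have [_ _ [sub _ _ _] _] := mmu.
by apply: sub; exact: sub_sigma_algebra.
Qed.

(** Real-valued form of the summand of the Riesz kernel with singularity [x]; the
power [-1] is the inverse, chosen since powers are measurable functions. *)
Definition pole x z : R := (mdist x z * (fine (mu (ball x (mdist x z)))) `^ (-1))%R.

Lemma pole_ge0 x z : (0 <= pole x z)%R.
Proof. by rewrite mulr_ge0 ?mdist_ge0// powR_ge0. Qed.

Lemma poleE x z : (pole x z)%:E = (mdist x z)%:E / mu (ball x (mdist x z)).
Proof.
have [->|xz] := eqVneq x z; first by rewrite /pole mdistxx mul0r mul0e.
have d0 : (0 < mdist x z)%R by rewrite mdist_gt0.
have := mu_ball_gt0 x d0; rewrite -{2}mu_ball_fineK -mu_ball_fineK lte_fin => m0.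
by rewrite inver gt_eqF// -EFinM /pole powR_inv1// ltW.
Qed.

Lemma borel_pole x : borel_fun (pole x : X -> R).
Proof.
apply: measurable_funM; first exact: borel_mdist.
apply: (measurableT_comp (measurable_powR _)).
suff mf : measurable_fun [set: R] (fun t => fine (mu (ball x t))).
  exact: (measurableT_comp mf (borel_mdist x)).
apply: nondecreasing_measurable => // s t st.
rewrite -lee_fin !mu_ball_fineK; apply: le_outer_measure.
exact: le_ball.
Qed.

End Balls.

Section BorelSlope.
Context {R : realType} {X : pmetricType R}.
Implicit Types (x y z w : X).

(** The slope is lower semicontinuous: a point [w] whose difference quotient with
[z] exceeds [r] does the same for all points near [z]. *)
Lemma borel_slope u (e : R) : Lip u -> borel_fun (slope u e : X -> \bar R).
Proof.
move=> [K uK]; apply: borel_lsc => r; rewrite openE => z /= rz.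
have [r0|r0] := ltP r 0%R.
  apply: filterS filterT => w _ /=; apply: lt_le_trans (slope_ge0 _ _ _).
  by rewrite lte_fin.
have [_ [->|[w [zw wz] <-]]] := ereal_sup_gt rz; first by rewrite lte_fin ltNge r0.
move: zw; rewrite ballEmdist/= => zw.
have d0 : (0 < mdist z w)%R by rewrite mdist_gt0; apply/eqP => /esym.
rewrite lte_fin ltr_pdivlMr// => rzw.
pose c := (`|K| + r + 1)%R; have c0 : (0 < c)%R by rewrite ltr_wpDl// addr_ge0.
pose del := Num.min ((`|u w - u z| - r * mdist z w) / c)%R
  (Num.min (e - mdist z w) (mdist z w))%R.
apply/nbhs_ballP; exists del.
  by rewrite /= /del !lt_min d0 subr_gt0 zw divr_gt0// subr_gt0.
move=> z'; rewrite ballEmdist/= /del !lt_min ltr_pdivlMr// => /and3P[zz'1 zz'2 zz'3].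
have d0' : (0 < mdist z' w)%R by have := metric_triangle z z' w; lra.
have wz' : w <> z' by move=> E; move: d0'; rewrite E mdistxx ltxx.
apply: (@lt_le_trans _ _ (`|u w - u z'| / mdist z' w)%:E); last first.
  apply: ereal_sup_ubound; right; exists w => //; split => //.
  by rewrite ballEmdist/=; have := metric_triangle z' z w; rewrite (metric_sym z' z); lra.
rewrite lte_fin ltr_pdivlMr//.
have tri : (mdist z' w <= mdist z z' + mdist z w)%R.
  by rewrite (metric_sym z z') metric_triangle.
have uz : (`|u z - u z'| <= `|K| * mdist z z')%R.
  by rewrite (le_trans (uK _ _))// ler_wpM2r ?mdist_ge0// ler_norm.
have ud : (`|u w - u z| <= `|u w - u z'| + `|u z - u z'|)%R.
  by rewrite (distrC (u z)) ler_distD.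
have := ler_wpM2l r0 tri; have := mdist_ge0 z z'.
move: zz'1; rewrite /c; set a := `|K|%R in uz *; set k := mdist z z' in uz *.
rewrite !mulrDr !mulr1 (mulrC k a) (mulrC k r); lra.
Qed.

Lemma borel_lip u : Lip u -> borel_fun (lip u : X -> \bar R).
Proof.
move=> uL; apply: (@emeasurable_fun_cvg _ (g_sigma_algebraType (@open X)) R setT
  (fun n => slope u n.+1%:R^-1) (lip u)).
  by move=> n; exact: borel_slope.
by move=> z _; exact: slope_cvg.
Qed.

End BorelSlope.

(** * The Riesz kernel *)

Section RieszKernel.
Context {R : realType} {X : pmetricType R}.
Variables (mu : {outer_measure set X -> \bar R}) (CD : R).
Hypotheses (mmu : metric_measure_space mu) (dmu : doubling CD mu) (CD1 : (1 <= CD)%R).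
Implicit Types (x y z : X) (r : R).
Let C := caratheodory_type mu.

(** The kernel vanishes at [x] and [y] by convention; removing these points by
open conditions makes its measurability evident. *)
Lemma riesz_kernelE L x y z : riesz_kernel mu L x y z =
  ((pole mu x z + pole mu y z) *
    \1_(two_balls L x y `&` [set t | (0 < mdist x t)%R]
         `&` [set t | (0 < mdist y t)%R]) z)%:E.
Proof.
rewrite /riesz_kernel; have [->|zx] := eqVneq z x.
  by rewrite [in RHS]indicE memNset ?mulr0 ?orbT// => -[[_ /=]]; rewrite mdistxx ltxx.
have [->|zy] := eqVneq z y.
  by rewrite [in RHS]indicE memNset ?mulr0 ?orbT// => -[_ /=]; rewrite mdistxx ltxx.
rewrite -!(poleE mmu dmu) -EFinD EFinM; congr (_ * (_)%:E).
rewrite !indicE; congr ((nat_of_bool _)%:R)%R.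
apply/idP/idP; rewrite !inE; last by case=> -[].
by split; [split|]; rewrite //= mdist_gt0 eq_sym.
Qed.

(** On the annulus between the radii [D / 2 ^ n.+1] and [D / 2 ^ n] the integrand
is at most [D / 2 ^ n] over the measure of the smaller ball, so by doubling the
annulus contributes at most [CD * D / 2 ^ n]. *)
Lemma integral_pole x D : (0 < D)%R ->
  \int[(mu : {measure set C -> \bar R})]_(z in setT)
    (pole mu x z * \1_(ball x D `&` [set t | (0 < mdist x t)%R]) z)%:E
  <= (2 * CD * D)%:E.
Proof.
move=> D0.
have two_neq0 n : (2 ^ n)%:R != 0%R :> R by rewrite pnatr_eq0 -lt0n expn_gt0.
pose rad n : R := (D / (2 ^ n)%:R)%R.
have rad0 n : (0 < rad n)%R by rewrite divr_gt0// ltr0n expn_gt0.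
have radS n : rad n = (2 * rad n.+1)%R.
  by rewrite /rad expnS natrM; move: (two_neq0 n); set k := _%:R => k0; field.
pose c n : R := (rad n / fine (mu (ball x (rad n.+1))))%R.
have m0 n : (0 < fine (mu (ball x (rad n))))%R.
  by rewrite -lte_fin mu_ball_fineK//; exact: (mu_ball_gt0 mmu dmu).
have c0 n : (0 <= c n)%R by rewrite divr_ge0// ltW.
pose F n z : \bar R := (c n)%:E * (\1_(ball x (rad n)) z)%:E.
have F0 n z : 0 <= F n z by rewrite mule_ge0// lee_fin.
have mB n : measurable (ball x (rad n) : set C).
  by apply: (open_caratheodory mmu); exact: metric_ball_open.
have m1 (A : set X) : measurable (A : set C) ->
    measurable_fun [set: C] (fun z : C => (\1_A z)%:E : \bar R).
  by move=> mA; apply/measurable_EFinP; exact: measurable_indic.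
have mF n : measurable_fun [set: C] (F n) by apply: measurable_funeM; exact: m1.
apply: (@le_trans _ _ (\int[(mu : {measure set C -> \bar R})]_(z in setT)
    \sum_(0 <= n <oo) F n z)).
  apply: ge0_le_integral => //.
  - by move=> z _; rewrite lee_fin mulr_ge0// pole_ge0.
  - apply/measurable_EFinP; apply: measurable_funM.
      exact: (borel_fun_caratheodory mmu (borel_pole mmu x)).
    apply: measurable_indic; apply: (open_caratheodory mmu); apply: openI.
      exact: metric_ball_open.
    exact: mdist_gt_open.
  - exact: ge0_emeasurable_sum.
  move=> z _; rewrite indicE.
  case: (boolP (z \in ball x D `&` [set t | (0 < mdist x t)%R])); last first.
    by rewrite mulr0 nneseries_ge0.
  rewrite inE => -[]; rewrite ballEmdist/= => xzD xz0.
  rewrite mulr1.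
  have [n [xzn nxz]] : exists n, (mdist x z < rad n)%R /\ (rad n.+1 <= mdist x z)%R.
    have ex : exists n, (rad n <= mdist x z)%R.
      exists (Num.bound (D / mdist x z)).
      rewrite ler_pdivrMr ?ltr0n ?expn_gt0// mulrC -ler_pdivrMr//.
      have q0 : (0 <= D / mdist x z)%R by rewrite divr_ge0 ?mdist_ge0// ltW.
      by rewrite (le_trans (ltW (archi_boundP q0)))// ler_nat ltnW// ltn_expl.
    case: (ex_minnP ex) => -[|n] nxz minn.
      by move: nxz; rewrite /rad expn0 divr1 leNgt xzD.
    by exists n; split => //; rewrite ltNge; apply/negP => /minn; rewrite ltnn.
  apply: (@le_trans _ _ (F n z)); last first.
    apply: le_trans (nneseries_lim_ge n.+1 _) => //.
    by rewrite big_nat_recr//= leeDr// sume_ge0.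
  rewrite /F indicE mem_set/=; last by rewrite ballEmdist.
  rewrite mule1 (poleE mmu dmu).
  have mz0 : 0 < mu (ball x (mdist x z)) by exact: (mu_ball_gt0 mmu dmu).
  have fz0 : (0 < fine (mu (ball x (mdist x z))))%R by rewrite -lte_fin mu_ball_fineK.
  rewrite -(mu_ball_fineK mmu) inver gt_eqF// -EFinM lee_fin /c.
  rewrite ler_pM ?mdist_ge0 ?invr_ge0 ?(ltW xzn) ?(ltW fz0)//.
  rewrite lef_pV2 ?posrE// -lee_fin !mu_ball_fineK//.
  by apply: le_outer_measure; exact: le_ball.
rewrite integral_nneseries//.
apply: le_trans (epsilon_trick0 predT _); last first.
  by rewrite !mulr_ge0// ?ltW// (lt_le_trans ltr01).
apply: lee_nneseries => n; first by move=> _ _; exact: integral_ge0.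
move=> _; have ind0 (z : C) : [set: C] z -> 0 <= (\1_(ball x (rad n)) z)%:E :> \bar R.
  by move=> _; rewrite lee_fin.
rewrite (ge0_integralZl_EFin _ measurableT ind0 (m1 _ (mB n)) (c0 n)).
rewrite integral_indic// setIT.
apply: (@le_trans _ _ ((c n)%:E * (CD%:E * mu (ball x (rad n.+1))))).
  by rewrite lee_wpmul2l ?lee_fin// radS; exact: dmu.
rewrite -(mu_ball_fineK mmu) -!EFinM lee_fin /c mulrCA divfK ?gt_eqF//.
rewrite le_eqVlt; apply/orP; left; apply/eqP.
by rewrite /rad expnS natrM; move: (two_neq0 n); set k := _%:R => k0; field.
Qed.

End RieszKernel.

(** * Powers of extended reals *)

Section Powers.
Context {R : realType}.
Implicit Types (a b : \bar R) (p : R).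

Lemma le_poweR p a b : (0 <= p)%R -> 0 <= a -> a <= b -> a `^ p <= b `^ p.
Proof.
move=> p0 a0 ab; apply: gt0_ler_poweR => //; rewrite in_itv/= ?leey ?andbT//.
exact: le_trans ab.
Qed.

Lemma poweR_leD p a b : (0 <= p)%R -> 0 <= a -> 0 <= b ->
  (a + b) `^ p <= (2 `^ p)%:E * (a `^ p + b `^ p).
Proof.
move=> p0 a0 b0.
wlog ab : a b a0 b0 / a <= b.
  by move=> H; have [/H->//|/ltW ba] := leP a b; rewrite addeC (addeC (_ `^ _)) H.
apply: (@le_trans _ _ ((2%:E * b) `^ p)).
  apply: le_poweR => //; first exact: adde_ge0.
  by rewrite mule_natl mule2n leeD2r.
by rewrite poweRM// poweR_EFin lee_wpmul2l ?lee_fin ?powR_ge0// leeDr// poweR_ge0.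
Qed.

(** The power [p] is an order isomorphism of the nonnegative extended reals, with
inverse the power [p^-1]. *)
Lemma ereal_inf_poweR (I : Type) (f : I -> \bar R) p : (0 < p)%R ->
  (forall i, 0 <= f i) ->
  ereal_inf (range (fun i => f i `^ p)) = (ereal_inf (range f)) `^ p.
Proof.
move=> p0 f0.
have inf0 : 0 <= ereal_inf (range f).
  by apply: le_ereal_inf_tmp => _ [i _ <-].
apply/eqP; rewrite eq_le; apply/andP; split; last first.
  apply: le_ereal_inf_tmp => _ [i _ <-]; apply: le_poweR => //; first exact: ltW.
  by apply: ereal_inf_lbound; exists i.
set t := ereal_inf _.
have t0 : 0 <= t by apply: le_ereal_inf_tmp => _ [i _ <-]; exact: poweR_ge0.
have pK a : 0 <= a -> (a `^ p) `^ p^-1 = a.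
  by move=> a0; rewrite -poweRrM divff ?gt_eqF// poweRe1.
have -> : t = (t `^ p^-1) `^ p by rewrite -poweRrM mulVf ?gt_eqF// poweRe1.
apply: le_poweR; rewrite ?poweR_ge0 ?(ltW p0)//.
apply: le_ereal_inf_tmp => _ [i _ <-]; rewrite -(pK (f i))//.
apply: le_poweR; rewrite ?invr_ge0 ?(ltW p0)//.
by apply: ereal_inf_lbound; exists i.
Qed.

End Powers.

(** * Integration against the Riesz kernel *)

Section RieszMass.
Context {R : realType} {X : pmetricType R}.
Variables (mu : {outer_measure set X -> \bar R}) (CD : R).
Hypotheses (mmu : metric_measure_space mu) (dmu : doubling CD mu) (CD1 : (1 <= CD)%R).
Implicit Types (x y z : X) (r : R).
Let C := caratheodory_type mu.

Lemma riesz_kernel_ge0 L x y z : 0 <= riesz_kernel mu L x y z.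
Proof.
by rewrite (riesz_kernelE mmu dmu) lee_fin mulr_ge0// addr_ge0// pole_ge0.
Qed.

Lemma riesz_kernel_fin_num L x y z : riesz_kernel mu L x y z \is a fin_num.
Proof. by rewrite (riesz_kernelE mmu dmu). Qed.

Lemma measurable_riesz_kernel L x y :
  measurable_fun [set: C] (riesz_kernel mu L x y).
Proof.
rewrite (funext (riesz_kernelE mmu dmu L x y)); apply/measurable_EFinP.
apply: measurable_funM.
  apply: measurable_funD; exact: (borel_fun_caratheodory mmu (borel_pole mmu _)).
apply: measurable_indic; apply: (open_caratheodory mmu); apply: openI; last first.
  exact: mdist_gt_open.
apply: openI; last exact: mdist_gt_open.
by apply: openU; exact: metric_ball_open.
Qed.

(** The two balls are contained in the balls of radius [(L + 1) * mdist x y] around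
each of the two poles. *)
Lemma riesz_mass_le L x y : (1 <= L)%R -> x != y ->
  \int[(mu : {measure set C -> \bar R})]_(z in setT) riesz_kernel mu L x y z
  <= (4 * CD * (L + 1) * mdist x y)%:E.
Proof.
move=> L1 xy; have d0 : (0 < mdist x y)%R by rewrite mdist_gt0.
pose D := ((L + 1) * mdist x y)%R.
have D0 : (0 < D)%R by rewrite mulr_gt0// addr_gt0// (lt_le_trans ltr01).
pose K t z : \bar R :=
  (pole mu t z * \1_(ball t D `&` [set w | (0 < mdist t w)%R]) z)%:E.
have K0 t z : 0 <= K t z by rewrite lee_fin mulr_ge0// pole_ge0.
have mK t : measurable_fun [set: C] (K t).
  apply/measurable_EFinP; apply: measurable_funM.
    exact: (borel_fun_caratheodory mmu (borel_pole mmu _)).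
  apply: measurable_indic; apply: (open_caratheodory mmu).
  by apply: openI; [exact: metric_ball_open|exact: mdist_gt_open].
apply: (@le_trans _ _ (\int[(mu : {measure set C -> \bar R})]_(z in setT)
    (K x z + K y z))).
  apply: ge0_le_integral => //.
  - by move=> z _; exact: riesz_kernel_ge0.
  - exact: measurable_riesz_kernel.
  - exact: emeasurable_funD.
  move=> z _; rewrite (riesz_kernelE mmu dmu) indicE.
  case: (boolP (_ \in _)); last by rewrite mulr0 adde_ge0.
  rewrite inE => -[[xyz /= xz0] yz0].
  have [xzD yzD] : (mdist x z < D)%R /\ (mdist y z < D)%R.
    have := metric_triangle x y z; have := metric_triangle y x z.
    rewrite (metric_sym y x) /D mulrDl mul1r.
    by case: xyz; rewrite ballEmdist/=; split; lra.
  rewrite mulr1 /K !indicE !mem_set ?mulr1//; split => //; rewrite ballEmdist//.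
rewrite ge0_integralD//.
have -> : (4 * CD * (L + 1) * mdist x y)%:E = (2 * CD * D)%:E + (2 * CD * D)%:E.
  by rewrite -EFinD /D; congr EFin; ring.
by rewrite leeD//; exact: (integral_pole mmu dmu).
Qed.

Lemma measurable_riesz_integrand L x y (f : X -> \bar R) p : borel_fun f ->
  measurable_fun [set: C] (fun z => f z `^ p * riesz_kernel mu L x y z).
Proof.
move=> bf; apply: emeasurable_funM; last exact: measurable_riesz_kernel.
by apply: (measurableT_comp (measurable_poweR _)); exact: (borel_fun_caratheodory mmu bf).
Qed.

Lemma riesz_integral_ge0 L x y (f : X -> \bar R) : (forall z, 0 <= f z) ->
  0 <= riesz_integral mu L x y f.
Proof.
by move=> f0; apply: integral_ge0 => z _; rewrite mule_ge0// riesz_kernel_ge0.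
Qed.

Lemma le_riesz_integral L x y p (f g : X -> \bar R) : (0 <= p)%R ->
  borel_fun f -> borel_fun g -> (forall z, 0 <= f z) -> (forall z, f z <= g z) ->
  riesz_integral mu L x y (fun z => f z `^ p) <=
  riesz_integral mu L x y (fun z => g z `^ p).
Proof.
move=> p0 bf bg f0 fg; apply: ge0_le_integral => //.
- by move=> z _; rewrite mule_ge0 ?poweR_ge0// riesz_kernel_ge0.
- exact: measurable_riesz_integrand.
- exact: measurable_riesz_integrand.
by move=> z _; rewrite lee_wpmul2r ?riesz_kernel_ge0// le_poweR.
Qed.

Lemma riesz_integral_addc_le L x y p (g : X -> \bar R) (l : R) :
  (0 <= p)%R -> (0 <= l)%R -> (1 <= L)%R -> x != y ->
  borel_fun g -> (forall z, 0 <= g z) ->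
  riesz_integral mu L x y (fun z => (g z + l%:E) `^ p) <=
  (2 `^ p)%:E * (riesz_integral mu L x y (fun z => g z `^ p) +
    (l `^ p * (4 * CD * (L + 1) * mdist x y))%:E).
Proof.
move=> p0 l0 L1 xy bg g0.
have bgl : borel_fun (fun z => g z + l%:E).
  by apply: (@emeasurable_funD _ (g_sigma_algebraType (@open X))).
pose c : R := (2 `^ p)%R; have c0 : (0 <= c)%R by exact: powR_ge0.
pose f1 z := g z `^ p * riesz_kernel mu L x y z.
pose f2 z := (l `^ p)%:E * riesz_kernel mu L x y z.
have f10 z : 0 <= f1 z by rewrite mule_ge0 ?poweR_ge0 ?riesz_kernel_ge0.
have f20 z : 0 <= f2 z by rewrite mule_ge0 ?lee_fin ?powR_ge0 ?riesz_kernel_ge0.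
have mf1 : measurable_fun [set: C] f1 by exact: measurable_riesz_integrand.
have mf2 : measurable_fun [set: C] f2.
  by apply: measurable_funeM; exact: measurable_riesz_kernel.
apply: (@le_trans _ _ (\int[(mu : {measure set C -> \bar R})]_(z in setT)
    (c%:E * (f1 z + f2 z)))).
  apply: ge0_le_integral => //.
  - by move=> z _; rewrite mule_ge0 ?poweR_ge0 ?riesz_kernel_ge0.
  - exact: measurable_riesz_integrand.
  - by apply: measurable_funeM; exact: emeasurable_funD.
  move=> z _; rewrite /f1 /f2 -ge0_muleDl ?poweR_ge0 ?lee_fin ?powR_ge0//.
  rewrite muleA lee_wpmul2r ?riesz_kernel_ge0//.
  by apply: poweR_leD; rewrite ?lee_fin.
rewrite ge0_integralZl_EFin//; last 2 first.
- by move=> z _; rewrite adde_ge0.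
- exact: emeasurable_funD.
rewrite ge0_integralD// lee_wpmul2l// leeD2l//.
rewrite ge0_integralZl_EFin ?powR_ge0//; last 2 first.
- by move=> z _; rewrite riesz_kernel_ge0.
- exact: measurable_riesz_kernel.
by rewrite EFinM lee_wpmul2l ?lee_fin ?powR_ge0//; exact: riesz_mass_le.
Qed.

End RieszMass.

(** * From chains to upper gradients and back to Lipschitz functions *)

Section Implications.
Context {R : realType} {X : pmetricType R}.
Variables (mu : {outer_measure set X -> \bar R}) (CD : R).
Hypotheses (mmu : metric_measure_space mu) (dmu : doubling CD mu) (CD1 : (1 <= CD)%R).
Variables (p : R) (p1 : (1 <= p)%R).
Implicit Types (x y z : X) (r e : R).
Let p0 : (0 < p)%R. Proof. exact: lt_le_trans ltr01 p1. Qed.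

Definition chain_energy g x y l e : \bar R :=
  ereal_inf [set chain_integral g x s `^ p | s in
    chain_between e x y `&` [set s | (chain_length x s <= l)%R]].

(** The energy is nonincreasing in the mesh, since there are fewer chains of
smaller mesh. *)
Lemma chain_energy_lim (g : X -> \bar R) x y l :
  lim (chain_energy g x y l e @[e --> 0^'+]) =
  ereal_sup [set chain_energy g x y l e | e in `]0%R, +oo[].
Proof.
apply/cvg_lim => //; apply: (nonincreasing_at_right_cvge (BInfty _ false)) => //.
move=> e1 e2 _ _ e12; apply: le_ereal_inf => _ [s [[s1 sy] sl] <-].
exists s => //; split => //; split => //.
by apply: sub_path s1 => a b /le_trans; apply.
Qed.

Lemma chain_connectivity_chain_poincare x y C L :
  chain_connectivity p mu x y C L -> chain_poincare p mu x y C L.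
Proof.
move=> cc u bu e e0 g [bg g0 ug] gx gy.
apply: le_trans (cc g bg g0 gx gy); rewrite chain_energy_lim.
apply: le_ereal_sup_tmp; exists (chain_energy g x y (C * mdist x y)%R e).
  by exists e => //=; rewrite in_itv/= e0.
apply: le_ereal_inf_tmp => _ [s [[xs sy] _] <-].
rewrite -poweR_EFin; apply: le_poweR; rewrite ?(ltW p0) ?lee_fin//.
by have := ug x s xs; rewrite sy distrC.
Qed.

Lemma slope_chain_bound (u : X -> R) e r q s : (r < e)%R -> chain r q s ->
  `|u (last q s) - u q|%:E <= chain_integral (slope u e) q s.
Proof.
move=> re; elim: s q => [|a s IH] q; first by rewrite subrr normr0 chain_integral_nil.
move=> /= /andP[qa /IH{}IH]; rewrite chain_integral_cons.
apply: (@le_trans _ _ (`|u a - u q|%:E + `|u (last a s) - u a|%:E)).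
  by rewrite -EFinD lee_fin (addrC `|_|%R) ler_distD.
apply: leeD => //; have [->|aq] := eqVneq a q.
  by rewrite subrr normr0 chain_step_ge0// => z; exact: slope_ge0.
have d0 : (0 < mdist q a)%R by rewrite mdist_gt0 eq_sym.
rewrite /chain_step muleC -lee_pdivrMl// muleC -EFinM.
have h1 : (`|u a - u q| / mdist q a)%:E <= slope u e q.
  apply: ereal_sup_ubound; right; exists a => //; split; last exact/eqP.
  by rewrite ballEmdist/=; lra.
have h2 : (`|u a - u q| / mdist q a)%:E <= slope u e a.
  apply: ereal_sup_ubound; right; exists q; last by rewrite distrC metric_sym.
  by split; [rewrite ballEmdist/= metric_sym; lra|move=> /esym/eqP; exact/negP].
rewrite lee_pdivlMr// -EFinM mulr_natr mulr2n EFinD.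
exact: leeD.
Qed.

(** The strict inequality [r < e] puts consecutive points of an [r]-chain in the
open balls of radius [e] of each other. *)
Lemma UG_slope (u : X -> R) e r : Lip u -> (r < e)%R -> UG r u (slope u e).
Proof.
move=> uL re; split; first exact: borel_slope.
- by move=> z; exact: slope_ge0.
- by move=> q s; exact: slope_chain_bound.
Qed.

Lemma slope_poweR_cvg (u : X -> R) z :
  slope u n.+1%:R^-1 z `^ p @[n --> \oo] --> lip u z `^ p.
Proof.
rewrite lip_inf_seq -ereal_inf_poweR//; last by move=> n; exact: slope_ge0.
apply: ereal_nonincreasing_cvgn => m n mn.
apply: le_poweR; rewrite ?(ltW p0) ?slope_ge0//.
by apply: le_slope; rewrite lef_pV2 ?posrE// ler_nat.
Qed.

Lemma borel_Lip (u : X -> R) : Lip u -> borel_fun u.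
Proof.
move=> [K uK]; apply: (measurability _ (RGenOInfty.measurableE R)).
move=> /= _ [_ [r ->]] <-; rewrite setTI; apply: sub_sigma_algebra.
rewrite preimage_itvoy openE => z /= ruz.
have K0 : (0 < `|K| + 1)%R by rewrite ltr_wpDl.
apply/nbhs_ballP; exists ((u z - r) / (`|K| + 1))%R.
  by rewrite /= divr_gt0// subr_gt0.
move=> w; rewrite ballEmdist/= ltr_pdivlMr// => zw.
have := uK z w; have := ler_norm (u z - u w).
have : (K * mdist z w <= mdist z w * (`|K| + 1))%R.
  by rewrite mulrC ler_wpM2l ?mdist_ge0// (le_trans (ler_norm _))// lerDl.
lra.
Qed.

Lemma chain_poincare_lip_poincare x y C L : (0 <= C)%R -> (1 <= L)%R ->
  chain_poincare p mu x y C L -> lip_poincare p mu x y C L.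
Proof.
move=> C0 L1 cp u uL.
have const0 : 0 <= (C * mdist x y `^ (p - 1))%:E :> \bar R.
  by rewrite lee_fin mulr_ge0// powR_ge0.
have [xy|xy] := eqVneq x y.
  rewrite {1}xy subrr normr0 powR0 ?gt_eqF// mule_ge0//.
  by apply: (riesz_integral_ge0 mmu dmu) => z; exact: poweR_ge0.
pose CC := caratheodory_type mu.
pose m := mu : {measure set CC -> \bar R}.
pose f n (z : CC) := slope u n.+1%:R^-1 z `^ p * riesz_kernel mu L x y z.
pose flim (z : CC) := lip u z `^ p * riesz_kernel mu L x y z.
have [K uK] := uL.
pose M : R := (`|K| `^ p)%R.
have slopeK e z : slope u e z <= `|K|%:E.
  apply: slope_le => // w _; rewrite -EFinM lee_fin distrC (le_trans (uK _ _))//.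
  by rewrite ler_wpM2r ?mdist_ge0// ler_norm.
have mf n : measurable_fun [set: CC] (f n).
  by apply: (measurable_riesz_integrand mmu dmu); exact: borel_slope.
have mflim : measurable_fun [set: CC] flim.
  by apply: (measurable_riesz_integrand mmu dmu); exact: borel_lip.
have f_cvg z : f n z @[n --> \oo] --> flim z.
  apply: cvgeZr; last exact: slope_poweR_cvg.
  exact: (riesz_kernel_fin_num mmu dmu).
have R0 z : 0 <= riesz_kernel mu L x y z by exact: (riesz_kernel_ge0 mmu dmu).
have f0 n z : 0 <= f n z by rewrite mule_ge0 ?poweR_ge0.
have intR : m.-integrable setT (fun z => M%:E * riesz_kernel mu L x y z).
  apply/integrableP; split.
    by apply: measurable_funeM; exact: (measurable_riesz_kernel mmu dmu).
  under eq_integral => z _ do rewrite gee0_abs ?mule_ge0 ?lee_fin ?powR_ge0//.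
  rewrite ge0_integralZl_EFin ?powR_ge0//; last first.
    exact: (measurable_riesz_kernel mmu dmu).
  apply: (@le_lt_trans _ _ (M%:E * (4 * CD * (L + 1) * mdist x y)%:E)).
    by rewrite lee_wpmul2l ?lee_fin ?powR_ge0//; exact: (riesz_mass_le mmu dmu).
  by rewrite -EFinM ltry.
have fR n z : `|f n z| <= M%:E * riesz_kernel mu L x y z.
  rewrite gee0_abs// lee_wpmul2r// -poweR_EFin.
  by apply: le_poweR; rewrite ?(ltW p0) ?slope_ge0.
have [_ _ icvg] : [/\ m.-integrable setT flim,
    [sequence \int[m]_z `|f n z - flim z|]_n @ \oo --> 0 &
    [sequence \int[m]_z f n z]_n @ \oo --> \int[m]_z flim z].
  apply: dominated_convergence intR _ => //.
    by apply: aeW => z _; exact: f_cvg.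
  by apply: aeW => z n _; exact: fR.
have finc : (C * mdist x y `^ (p - 1))%:E \is a fin_num by [].
apply: (cvge_ge _ (cvgeZl finc icvg)).
apply: nearW => n.
have e0 : (0 < n.+1%:R^-1 / 2 :> R)%R by rewrite divr_gt0.
have ne : (n.+1%:R^-1 / 2 < n.+1%:R^-1 :> R)%R by rewrite gtr_pMr// invf_lt1// ltr1n.
have ltyK z : slope u n.+1%:R^-1 z < +oo by rewrite (le_lt_trans (slopeK _ _))// ltry.
exact: (cp u (borel_Lip uL) _ e0 _ (UG_slope uL ne) (ltyK x) (ltyK y)).
Qed.

End Implications.

(** * From Lipschitz functions to chain connectivity *)

Section LipToChains.
Context {R : realType} {X : pmetricType R}.
Variables (mu : {outer_measure set X -> \bar R}) (CD : R).
Hypotheses (mmu : metric_measure_space mu) (dmu : doubling CD mu) (CD1 : (1 <= CD)%R).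
Variables (p : R) (p1 : (1 <= p)%R).
Implicit Types (x y z : X) (r e : R).
Let p0 : (0 < p)%R. Proof. exact: lt_le_trans ltr01 p1. Qed.

(** The bound that [chain_of_Lip_bound] needs for [g + l]: raise to the power [p],
use (i) and [riesz_integral_addc_le], and take the [p]-th root. *)
Lemma lip_poincare_le x y C L (g : X -> \bar R) (l i A : R) :
  (0 <= C)%R -> (0 <= l)%R -> (1 <= L)%R -> x != y -> (0 <= A)%R ->
  lip_poincare p mu x y C L -> borel_fun g -> (forall z, 0 <= g z) ->
  riesz_integral mu L x y (fun z => g z `^ p) <= i%:E ->
  (C * mdist x y `^ (p - 1) * (2 `^ p * (i + l `^ p * (4 * CD * (L + 1) * mdist x y)))
    <= A `^ p)%R ->
  forall u, Lip u -> (forall z, lip u z <= g z + l%:E) -> (`|u x - u y| <= A)%R.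
Proof.
move=> C0 l0 L1 xy A0 lp bg g0 gi CA u uL ug.
rewrite leNgt; apply/negP => /(gt0_ltr_powR p0); rewrite !nnegrE => /(_ A0 (normr_ge0 _)).
apply/negP; rewrite -leNgt; apply: le_trans CA.
have const0 : 0 <= (C * mdist x y `^ (p - 1))%:E :> \bar R.
  by rewrite lee_fin mulr_ge0// powR_ge0.
rewrite -lee_fin EFinM; apply: (le_trans (lp u uL)); rewrite lee_wpmul2l//.
have bgl : borel_fun (fun z => g z + l%:E).
  by apply: (@emeasurable_funD _ (g_sigma_algebraType (@open X))).
apply: (le_trans (le_riesz_integral mmu dmu L x y (ltW p0)
  (borel_lip uL) bgl (@lip_ge0 _ _ u) ug)).
apply: (le_trans (riesz_integral_addc_le mmu dmu CD1 (ltW p0) l0 L1 xy bg g0)).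
by rewrite [leRHS]EFinM lee_wpmul2l ?lee_fin ?powR_ge0// EFinD leeD2r.
Qed.

(** Let [I] be the integral of [g `^ p], let [d] be the distance of [x] and [y] and
choose [l] with [l `^ p * c * d = I + k], where [k > 0] is arbitrary
and keeps [l] positive when [I = 0].  The hypothesis then bounds the oscillation of
the test functions by [A = B * l * d], which gives chains with integral of [g + l] at most
[33 * A]; so their length is at most [33 * A / l = 33 * B * d], and the power [p]
of the integral of [g] is at most
[(33 * A) `^ p = (33 * B) `^ p / c * d `^ (p - 1) * (I + k)]. *)
Lemma lip_poincare_chain_connectivity x y C L :
  let c := (4 * CD * (L + 1))%R in
  let B := ((2 * 2 `^ p * C * c) `^ p^-1)%R in
  let C' := (33 * B + (33 * B) `^ p / c)%R in
  (0 < C)%R -> (1 <= L)%R ->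
  lip_poincare p mu x y C L -> chain_connectivity p mu x y C' L.
Proof.
move=> c B C' C0 L1 lp g bg g0 gx gy; rewrite chain_energy_lim.
have c0 : (0 < c)%R.
  by rewrite mulr_gt0 ?mulr_gt0 ?addr_gt0// (lt_le_trans ltr01).
have Bc0 : (0 < 2 * 2 `^ p * C * c)%R 
  by rewrite mulr_gt0// mulr_gt0// mulr_gt0// powR_gt0.
have B0 : (0 < B)%R by exact: powR_gt0.
have Bp : (B `^ p = 2 * 2 `^ p * C * c)%R.
  by rewrite /B -powRrM mulVf ?gt_eqF// powRr1// ltW.
have C'1 : (33 * B <= C')%R by rewrite lerDl divr_ge0 ?powR_ge0// ltW.
have C'2 : ((33 * B) `^ p / c <= C')%R by rewrite lerDr mulr_ge0// ltW.
have C'0 : (0 < C')%R by rewrite (lt_le_trans _ C'1)// mulr_gt0.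
have int0 : 0 <= riesz_integral mu L x y (fun z => g z `^ p).
  by apply: (riesz_integral_ge0 mmu dmu) => z; exact: poweR_ge0.
apply: ge_ereal_sup => t [e /=]; rewrite in_itv/= andbT => e0 <-{t}.
have [xy|xy] := eqVneq x y.
  apply: ge_ereal_inf; exists (chain_integral g x [::] `^ p).
    exists [::] => //; split=> //=.
    by rewrite chain_length_nil mulr_ge0 ?mdist_ge0// ltW.
  rewrite chain_integral_nil poweR0r ?gt_eqF// mule_ge0// lee_fin.
  by rewrite mulr_ge0 ?powR_ge0// ltW.
have d0 : (0 < mdist x y)%R by rewrite mdist_gt0.
set d := mdist x y in d0 *.
have dp0 : (0 < d `^ (p - 1))%R by exact: powR_gt0.
have [intoo|] := ltP (riesz_integral mu L x y (fun z => g z `^ p)) +oo; last first.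
  by rewrite leye_eq => /eqP ->; rewrite gt0_muley ?leey// lte_fin mulr_gt0.
set I := riesz_integral _ _ _ _ _ in int0 intoo *.
have /fineK IE : I \is a fin_num by rewrite ge0_fin_numE.
have i0 : (0 <= fine I)%R by exact: fine_ge0.
apply/lee_addgt0Pr => k' k'0.
pose k := (k' / (C' * d `^ (p - 1)))%R.
have k0 : (0 < k)%R by rewrite divr_gt0// mulr_gt0.
have k'E : (C' * d `^ (p - 1) * k = k')%R.
  by rewrite mulrCA divff ?mulr1// gt_eqF// mulr_gt0.
have cd0 : (0 < c * d)%R by rewrite mulr_gt0.
have q0 : (0 < (fine I + k) / (c * d))%R by rewrite divr_gt0// ltr_wpDl.
pose l := (((fine I + k) / (c * d)) `^ p^-1)%R.
have l0 : (0 < l)%R by exact: powR_gt0.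
have lp' : (l `^ p * (c * d) = fine I + k)%R.
  by rewrite /l -powRrM mulVf ?gt_eqF// powRr1 ?divfK ?gt_eqF// ltW.
have dp : (d * d `^ (p - 1) = d `^ p)%R by rewrite mulr_powRB1// ltW.
pose A := (B * l * d)%R.
have A0 : (0 < A)%R by rewrite !mulr_gt0.
have Ap : (A `^ p = 2 * C * 2 `^ p * d `^ (p - 1) * (fine I + k))%R.
  rewrite /A powRM ?mulr_ge0 ?(ltW B0) ?(ltW l0) ?(ltW d0)//.
  by rewrite powRM ?(ltW B0) ?(ltW l0)// Bp -lp' -dp; ring.
have uA u : Lip u -> (forall z, lip u z <= g z + l%:E) -> (`|u x - u y| <= A)%R.
  apply: (lip_poincare_le (ltW C0) (ltW l0) L1 xy (ltW A0) lp bg g0 (i := fine I)).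
    by rewrite IE.
  rewrite -/d -/c lp' Ap.
  have t0 : (0 <= C * 2 `^ p * d `^ (p - 1))%R by rewrite !mulr_ge0 ?powR_ge0// ltW.
  rewrite -subr_ge0 (_ : _ - _ = C * 2 `^ p * d `^ (p - 1) * k)%R; last by ring.
  by rewrite mulr_ge0// ltW.
have lgl z : l%:E <= g z + l%:E by rewrite leeDr.
have glx : g x + l%:E < +oo by rewrite lte_add_pinfty// ltry.
have gly : g y + l%:E < +oo by rewrite lte_add_pinfty// ltry.
have [s xsy sA] := chain_of_Lip_bound l0 A0 lgl glx gly uA e0.
apply: ge_ereal_inf; exists (chain_integral g x s `^ p).
  exists s => //; split => //=; apply: le_trans (_ : 33 * B * d <= _)%R; last first.
    by rewrite ler_wpM2r// ltW.
  rewrite -(ler_pM2l l0) (_ : l * (33 * B * d) = 33 * A)%R; last by rewrite /A; ring.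
  by rewrite -lee_fin (le_trans _ sA)// chain_integral_lbound// ltW.
have -> : (C' * d `^ (p - 1))%:E * I + k'%:E = (C' * d `^ (p - 1) * (fine I + k))%:E.
  by rewrite -IE -EFinM -EFinD mulrDr k'E.
apply: (@le_trans _ _ ((33 * A)%:E `^ p)).
  apply: le_poweR; rewrite ?(ltW p0)//; first exact: chain_integral_ge0.
  by apply: le_trans sA; apply: le_chain_integral => // z; rewrite leeDl// lee_fin ltW.
rewrite poweR_EFin lee_fin.
have h33 : (0 <= 33 * B)%R by rewrite mulr_ge0// ltW.
have h33l : (0 <= 33 * B * l)%R by rewrite mulr_ge0// ltW.
have -> : ((33 * A) `^ p = (33 * B) `^ p * l `^ p * d `^ p)%R.
  rewrite (_ : 33 * A = 33 * B * l * d)%R; last by rewrite /A; ring.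
  by rewrite (powRM _ h33l (ltW d0)) (powRM _ h33 (ltW l0)).
apply: (@le_trans _ _ ((33 * B) `^ p / c * d `^ (p - 1) * (fine I + k))%R).
  rewrite -lp' -dp le_eqVlt; apply/orP; left; apply/eqP.
  by move: ((33 * B) `^ p)%R (l `^ p)%R (d `^ (p - 1))%R => a1 a2 a3; field; rewrite gt_eqF.
rewrite ler_wpM2r ?addr_ge0 ?(ltW k0)// ler_wpM2r// ltW//.
Qed.

End LipToChains.

Section Transitivity.
Context {R : realType}.

Lemma quantitatively_implies_trans (P Q S : two_point_property R) :
  quantitatively_implies P Q -> quantitatively_implies Q S ->
  quantitatively_implies P S.
Proof.
move=> PQ QS CD C L CD1 C0 L1.
have [C1 [L2 [C10 L21 pq]]] := PQ CD C L CD1 C0 L1.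
have [C2 [L3 [C20 L31 qs]]] := QS CD C1 L2 CD1 C10 L21.
exists C2, L3; split => // X mu mmu dmu x y Pxy.
exact: (qs X mu mmu dmu x y (pq X mu mmu dmu x y Pxy)).
Qed.

End Transitivity.

Local Close Scope ereal_scope.
Theorem proposition7p6 (R : realType) (p : R) (hp : 1 <= p) :
  [/\ quantitatively_equivalent
        (fun X mu => @lip_poincare R X p mu)
        (fun X mu => @chain_connectivity R X p mu),
      quantitatively_equivalent
        (fun X mu => @chain_connectivity R X p mu)
        (fun X mu => @chain_poincare R X p mu) &
      quantitatively_equivalent
        (fun X mu => @lip_poincare R X p mu)
        (fun X mu => @chain_poincare R X p mu)].
Proof.
have i_ii : quantitatively_implies
    (fun X mu => @lip_poincare R X p mu) (fun X mu => @chain_connectivity R X p mu).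
  move=> CD C L CD1 C0 L1.
  pose c := 4 * CD * (L + 1).
  have c0 : 0 < c by rewrite mulr_gt0 ?mulr_gt0 ?addr_gt0// (lt_le_trans ltr01).
  pose B := (2 * 2 `^ p * C * c) `^ p^-1.
  exists (33 * B + (33 * B) `^ p / c), L; split => //.
    by rewrite ltr_pwDl ?divr_ge0 ?powR_ge0 ?(ltW c0)// mulr_gt0// powR_gt0//
       mulr_gt0// mulr_gt0// mulr_gt0// powR_gt0.
  move=> X mu mmu dmu x y; exact: (lip_poincare_chain_connectivity mmu dmu CD1 hp C0 L1).
have ii_iii : quantitatively_implies
    (fun X mu => @chain_connectivity R X p mu) (fun X mu => @chain_poincare R X p mu).
  move=> CD C L CD1 C0 L1; exists C, L; split => // X mu mmu dmu x y.
  exact: chain_connectivity_chain_poincare.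
have iii_i : quantitatively_implies
    (fun X mu => @chain_poincare R X p mu) (fun X mu => @lip_poincare R X p mu).
  move=> CD C L CD1 C0 L1; exists C, L; split => // X mu mmu dmu x y.
  exact: (chain_poincare_lip_poincare mmu dmu CD1 hp (ltW C0) L1).
split; split => //.
- exact: quantitatively_implies_trans ii_iii iii_i.
- exact: quantitatively_implies_trans iii_i i_ii.
- exact: quantitatively_implies_trans i_ii ii_iii.
Qed.
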